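(* Let $V$ be a vector space over a field $K$, with $\dim V \geq 1$ (infinite dimension allowed). Then: a) If $\min(\dim V, \# K)$ is finite, then $\operatorname{AC}(V) = \# K$. b) If $\dim V$ and $\# K$ are both infinite, then $\operatorname{AC}(V) = \aleph_0$. c) $\operatorname{IAC}(V) = \# K$.
   Context: $\# S$ denotes the cardinality of a set $S$, and $\dim V$ denotes the cardinality of any $K$-basis of $V$, a possibly infinite cardinal. An affine covering of a $K$-vector space $V$ is a collection $\{A_i\}_{i \in I}$ of translates of proper $K$-linear subspaces of $V$ (that is, each $A_i = v_i + W_i$ with $v_i \in V$ and $W_i \subsetneq V$ a linear subspace) such that $V = \bigcup_{i \in I} A_i$. An affine covering is irredundant if no proper subcollection covers $V$, i.e. $\bigcup_{i \in J} A_i \neq V$ for every $J \subsetneq I$. Irredundant affine coverings exist if and only if $\dim V \geq 1$. The affine covering number $\operatorname{AC}(V)$ is the least cardinality $\# I$ of an affine covering of $V$, and the irredundant affine covering number $\operatorname{IAC}(V)$ is the least cardinality of an irredundant affine covering of $V$. *)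

(* Defs.v *)
From mathcomp Require Export all_boot all_order all_algebra finmap.
From mathcomp Require Export mathcomp_extra boolp classical_sets functions.
From mathcomp Require Export cardinality.

Set Implicit Arguments.
Unset Strict Implicit.
Unset Printing Implicit Defensive.

Import GRing.Theory.
Local Open Scope classical_set_scope.
Local Open Scope card_scope.
Local Open Scope ring_scope.

(* A cardinal number is encoded, after Frege, as the class of all sets having
   that cardinality; by extensionality, [card_of A = card_of B] amounts to
   [A #= B] (see [card_of_eqP]). The encoding has junk (classes that are not
   the class of any set, such as the empty one), but no junk value is ever
   equal to a [card_of A]. *)
Definition cardinal : Type := forall T : Type, set T -> Prop.

Definition card_of (T : Type) (A : set T) : cardinal := fun U B => A #= B.

Definition cardinal_le (c d : cardinal) : Prop :=
  exists (T : Type) (A : set T) (U : Type) (B : set U),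
    [/\ c T A, d U B & A #<= B].

Definition cardinal_min (c d : cardinal) : cardinal :=
  if `[< cardinal_le c d >] then c else d.

Definition cardinal_finite (c : cardinal) : Prop :=
  exists (T : Type) (A : set T), c T A /\ finite_set A.

Definition aleph0 : cardinal := card_of [set: nat].

Definition is_least_cardinal (P : cardinal -> Prop) (c : cardinal) : Prop :=
  P c /\ forall d, P d -> cardinal_le c d.

(* The least cardinal satisfying P; it is the empty class if there is none. *)
Definition least_cardinal (P : cardinal -> Prop) : cardinal :=
  fun T A => is_least_cardinal P (card_of A).

Section VectorSpace.
Variables (K : fieldType) (V : lmodType K).

Definition lin_indep (B : set V) : Prop :=
  forall (X : {fset V}) (a : V -> K), [set` X] `<=` B ->
    \sum_(v <- X) a v *: v = 0 -> forall v, v \in X -> a v = 0.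

Definition spanning (B : set V) : Prop :=
  forall x : V, exists (X : {fset V}) (a : V -> K),
    [set` X] `<=` B /\ x = \sum_(v <- X) a v *: v.

Definition is_basis (B : set V) : Prop := lin_indep B /\ spanning B.

(* Since any two bases are equipotent, this is the cardinality of any basis. *)
Definition vdim : cardinal :=
  fun T A => exists2 B : set V, is_basis B & card_of B A.

Definition proper_affine (A : set V) : Prop :=
  exists (v : V) (W : set V),
    [/\ GRing.submod_closed [in W], W != setT & A = [set v + w | w in W]].

(* The index set J is a subset of an arbitrary type; values of the family
   outside J are irrelevant. *)
Definition affine_covering (I : Type) (J : set I) (A : I -> set V) : Prop :=
  (forall i, J i -> proper_affine (A i)) /\ \bigcup_(i in J) A i = setT.

Definition irredundant_affine_covering
    (I : Type) (J : set I) (A : I -> set V) : Prop :=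
  affine_covering J A /\
  forall J' : set I, J' `<` J -> \bigcup_(i in J') A i <> setT.

Definition AC : cardinal := least_cardinal (fun c =>
  exists (I : Type) (J : set I) (A : I -> set V),
    affine_covering J A /\ c = card_of J).

Definition IAC : cardinal := least_cardinal (fun c =>
  exists (I : Type) (J : set I) (A : I -> set V),
    irredundant_affine_covering J A /\ c = card_of J).

End VectorSpace.

Arguments vdim {K} V.
Arguments AC {K} V.
Arguments IAC {K} V.

Lemma card_of_eqP (T U : Type) (A : set T) (B : set U) :
  card_of A = card_of B <-> A #= B.
Proof.
split=> [AB|AB].
  have : card_of B B by rewrite /card_of.
  by rewrite -AB.
apply: functional_extensionality_dep => W.
apply: functional_extensionality_dep => C.
by rewrite /card_of (card_eql AB).
Qed.

Lemma cardinal_le_card_of (T U : Type) (A : set T) (B : set U) :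
  cardinal_le (card_of A) (card_of B) <-> A #<= B.
Proof.
split=> [[T' [A' [U' [B' [AA' BB' le]]]]]|le]; last first.
  by exists T, A, U, B; split; rewrite /card_of.
by rewrite /card_of in AA' BB'; rewrite (card_le_eql AA') (card_le_eqr BB').
Qed.

Lemma cardinal_finite_card_of (T : Type) (A : set T) :
  cardinal_finite (card_of A) <-> finite_set A.
Proof.
split=> [[U [B [AB Bfin]]]|Afin]; last first.
  by exists T, A; split; rewrite /card_of.
by rewrite /card_of in AB; rewrite (eq_finite_set AB).
Qed.

Lemma least_cardinalP (P : cardinal -> Prop) (T : Type) (A : set T) :
  least_cardinal P = card_of A <-> is_least_cardinal P (card_of A).
Proof.
split=> [e|[PA minA]].
  suff : least_cardinal P A by [].
  by rewrite e /card_of.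
apply: functional_extensionality_dep => U.
apply: functional_extensionality_dep => B.
apply: propext; split=> [[PB minB]|AB].
  rewrite /card_of card_eq_le.
  by apply/andP; split; apply/cardinal_le_card_of; [exact: minA|exact: minB].
by rewrite /least_cardinal -(card_of_eqP A B).2.
Qed.

(* Main.v *)
(** A finitely generated flat that is covered by affine sets, none of which
    contains it, needs at least #K of them. By induction on the generators:
    split the flat into parallel subflats H_t, t in K; if one of them lies in no
    member of the covering, induct; otherwise each H_t lies in some member, and
    no member contains two of them, since it would then contain the whole flat.
    All lower bounds follow by choosing the flat: the whole space in finite
    dimension, the span of points avoided by each member when the covering is
    finite, and, when it is irredundant, the line joining a point covered only
    by one member to a point outside that member. The upper bounds are given by
    the level sets of a coordinate function and, in infinite dimension, by the
    increasing subspaces on which almost all of the coordinates along a sequence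
    of basis vectors vanish. *)
Require Import Defs.
From mathcomp Require Import ring.

Set Implicit Arguments.
Unset Strict Implicit.
Unset Printing Implicit Defensive.

Import GRing.Theory.
Local Open Scope classical_set_scope.
Local Open Scope ring_scope.

(** * Flats and the size of their coverings *)

Section Flats.
Variables (K : fieldType) (V : lmodType K).
Implicit Types (x y v : V) (s : seq V) (A : set V).

(** This is the translate by [x] of the span of [s], where [s] may be dependent. The recursion
    exhibits the parallel subflats used in the induction. *)
Fixpoint flat x s : set V :=
  if s is v :: s' then \bigcup_(t in [set: K]) flat (x + t *: v) s' else [set x].

Lemma flat_translate u x s y : flat x s y -> flat (x + u) s (y + u).
Proof.
elim: s x => [|v s IHs] x /=; first by move=> ->.
by move=> [t _ /IHs sy]; exists t => //; rewrite addrAC.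
Qed.

Lemma flat_sum (a : V -> K) x s : flat x s (x + \sum_(v <- s) a v *: v).
Proof.
elim: s x => [|v s IHs] x /=; first by rewrite big_nil addr0.
by exists (a v) => //; rewrite big_cons addrA.
Qed.

Lemma flat_base x s : flat x s x.
Proof.
by have := flat_sum (fun=> 0) x s; rewrite big1 ?addr0 // => v; rewrite scale0r.
Qed.

Lemma flat_mem x s v : v \in s -> flat x s (x + v).
Proof.
elim: s x => [//|w s IHs] x /=; rewrite inE => /orP[/eqP->|vs].
  by exists 1 => //; rewrite scale1r; exact: flat_base.
by exists 0 => //; rewrite scale0r addr0; exact: IHs.
Qed.

(** A stand-in for being affine; over the field with two elements it holds for every set. *)
Definition line_closed A :=
  forall x y (r : K), A x -> A y -> A (x + r *: (y - x)).

Lemma line_closed_flat_cons A x v s (t u : K) : line_closed A -> t != u ->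
  flat (x + t *: v) s `<=` A -> flat (x + u *: v) s `<=` A ->
  flat x (v :: s) `<=` A.
Proof.
move=> Aline tu At Au y [r _ ry].
have shift w : flat (x + w *: v) s (y + (w - r) *: v).
  rewrite (_ : x + w *: v = x + r *: v + (w - r) *: v).
    exact: flat_translate.
  by rewrite -addrA -scalerDl (addrC r) subrK.
(* The line through [y] in direction [v] meets the two subflats at [y + (t - r) *: v] and
   [y + (u - r) *: v]; this ratio is the parameter of [y] on it. *)
have := Aline _ _ ((r - t) / (u - t)) (At _ (shift t)) (Au _ (shift u)).
rewrite (_ : _ + _ = y) //.
rewrite opprD addrACA subrr add0r -scalerBl scalerA -addrA -scalerDl.
rewrite [X in X *: v](_ : _ = 0) ?scale0r ?addr0 //.
by field; rewrite subr_eq0 eq_sym.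
Qed.

Lemma flat_cover_card (I : Type) (J : set I) (A : I -> set V) s x :
  (forall i, J i -> line_closed (A i)) ->
  flat x s `<=` \bigcup_(i in J) A i ->
  (forall i, J i -> ~ (flat x s `<=` A i)) ->
  ([set: K] #<= J)%card.
Proof.
move=> Aline; elim: s x => [|v s IHs] x cover nsub.
  by have [|i Ji Aix] := cover x; [exact: erefl|case: (nsub i Ji) => _ ->].
have [[t nt]|/forallNP subt] := pselect (exists t : K, forall i, J i ->
    ~ (flat (x + t *: v) s `<=` A i)).
  by apply: (IHs (x + t *: v)) => // y ty; apply: cover; exists t.
have /choice[f fP] : forall t : K, exists i : I,
    J i /\ flat (x + t *: v) s `<=` A i.
  move=> t; have /existsNP[i /not_implyP[Ji /contrapT tA]] := subt t.
  by exists i.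
(* A member containing two distinct subflats would contain the whole flat, against [nsub]. *)
have finj : {in [set: K] &, injective f}.
  move=> t u _ _ tu; apply: contrapT => /eqP ntu.
  have [Jt At] := fP t; have [_ Au] := fP u; rewrite -tu in Au.
  exact: (nsub (f t) Jt (line_closed_flat_cons (Aline _ Jt) ntu At Au)).
rewrite -(card_le_eql (inj_card_eq finj)).
by apply: subset_card_le => _ [t _ <-]; have [] := fP t.
Qed.

End Flats.

(** * Lower bounds for affine coverings *)

Section AffineCoverings.
Variables (K : fieldType) (V : lmodType K).

Lemma proper_affine_line_closed (A : set V) : proper_affine A -> line_closed A.
Proof.
move=> [v [W [[_ Wlin] _ ->]]] _ _ r [w Ww <-] [z Wz <-].
exists (r *: (z - w) + w); last first.
  by rewrite opprD addrACA subrr add0r -addrA [w + _]addrC.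
apply/set_mem/Wlin; last exact/mem_set.
by rewrite addrC -scaleN1r; apply: Wlin; exact/mem_set.
Qed.

Lemma proper_affine_notin (A : set V) : proper_affine A -> exists x, ~ A x.
Proof.
move=> [v [W [_ /eqP WT ->]]]; apply: contrapT => /forallNP AT.
apply: WT; apply/seteqP; split=> // w _.
by have /contrapT[z Wz /addrI <-] := AT (v + w).
Qed.

Variables (I : Type) (J : set I) (A : I -> set V).
Hypothesis AJ : affine_covering J A.

Let Aline i : J i -> line_closed (A i).
Proof. by case: AJ => Aprop _ /Aprop/proper_affine_line_closed. Qed.

Let cover (x : V) : exists2 i, J i & A i x.
Proof. by case: AJ => _ AT; have : setT x by []; rewrite -AT. Qed.

Let flat_card x s : (forall i, J i -> ~ (flat x s `<=` A i)) ->
  ([set: K] #<= J)%card.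
Proof. by apply: flat_cover_card => // y _; have [i] := cover y; exists i. Qed.

Lemma finite_affine_covering_card : finite_set J -> ([set: K] #<= J)%card.
Proof.
move=> Jfin.
(* [y i] is a point missed by [A i]; outside [J] the value 0 is a dummy. *)
have /choice[y yP] i : exists x, J i -> ~ A i x.
  have [Ji|nJi] := pselect (J i); last by exists 0.
  by have [x] := proper_affine_notin (AJ.1 i Ji); exists x.
have /finite_seqP[s sE] : finite_set (y @` J) by exact: finite_image.
apply: (@flat_card 0 s) => i Ji sub.
apply: (yP i Ji); apply: sub; rewrite -[y i]add0r; apply: flat_mem.
have : (y @` J) (y i) by exists i.
by rewrite sE.
Qed.

Lemma fin_dim_affine_covering_card (B : set V) :
  spanning B -> finite_set B -> ([set: K] #<= J)%card.
Proof.
move=> Bspan Bfin; pose s := fset_set B.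
have sT x : flat 0 s x.
  have [X [a [XB ->]]] := Bspan x.
  (* Extending the coefficients by zero turns the sum over [X] into one over all of [B]. *)
  rewrite (eq_big_seq (fun v => (if v \in X then a v else 0) *: v)); last first.
    by move=> v /= ->.
  rewrite (big_fset_incl _ (B := s)) /=.
  - by rewrite -[\sum_(_ <- _) _]add0r; exact: flat_sum.
  - by apply/fsubsetP => v vX; rewrite in_fset_set //; exact/mem_set/XB.
  - by move=> v _ /negbTE->; rewrite scale0r.
apply: (@flat_card 0 s) => i Ji sub.
by have [x] := proper_affine_notin (AJ.1 i Ji); apply; exact: sub.
Qed.

Lemma irredundant_affine_covering_card :
  irredundant_affine_covering J A -> ([set: K] #<= J)%card.
Proof.
move=> [_ irr]; have [i0 Ji0 _] := cover 0.
(* If no point were covered by [i0] alone, the covering would survive the removal of [i0]. *)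
have [x xP] : exists x, forall i, J i -> A i x -> i = i0.
  apply: contrapT => /forallNP nx.
  apply: (irr (J `\ i0)).
    by split=> [i []//|sub]; have [_] := sub i0 Ji0; apply.
  apply/seteqP; split=> // x _.
  have /existsNP[i /not_implyP[Ji /not_implyP[Aix ni]]] := nx x.
  by exists i.
have [y Ay] := proper_affine_notin (AJ.1 i0 Ji0).
(* A member containing the line through [x] and [y] contains [x], hence is [A i0], which misses
   [y]. *)
apply: (@flat_card x [:: y - x]) => i Ji sub.
have ii0 : i = i0 by apply: xP => //; apply: sub; exact: flat_base.
apply: Ay; rewrite -ii0; apply: sub.
have := @flat_mem _ _ x [:: y - x] (y - x).
by rewrite [x + _]addrC subrK; apply; rewrite inE.
Qed.

End AffineCoverings.

(** * Coordinates with respect to a basis *)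

Section Coordinates.
Variables (K : fieldType) (V : lmodType K) (B : set V).

(** Since [g] vanishes off [X], a vector determines [g] as a function on all of [V] when [B] is a
    basis. *)
Definition expansion (x : V) (g : V -> K) := exists X : {fset V},
  [/\ [set` X] `<=` B, forall v, v \notin X -> g v = 0
    & x = \sum_(v <- X) g v *: v].

Lemma expansion_sum (X Y : {fset V}) (g : V -> K) : (X `<=` Y)%fset ->
  (forall v, v \notin X -> g v = 0) ->
  \sum_(v <- X) g v *: v = \sum_(v <- Y) g v *: v.
Proof.
by move=> XY g0; apply: big_fset_incl => // v _ /g0 ->; rewrite scale0r.
Qed.

Lemma expansionP k x y g h : expansion x g -> expansion y h ->
  expansion (k *: x + y) (fun v => k * g v + h v).
Proof.
move=> [X [XB gX ->]] [Y [YB hY ->]]; exists (X `|` Y)%fset; split.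
- by move=> v /=; rewrite inE => /orP[/XB|/YB].
- by move=> v; rewrite inE negb_or => /andP[/gX-> /hY->]; rewrite mulr0 addr0.
rewrite (expansion_sum (fsubsetUl X Y) gX) (expansion_sum (fsubsetUr X Y) hY).
rewrite scaler_sumr -big_split /=; apply: eq_bigr => v _.
by rewrite scalerA -scalerDl.
Qed.

(** Expansions are unique, so the first two properties only require exhibiting an expansion with the
    stated coefficients. *)
Lemma basis_coordinates : is_basis B -> exists c : V -> V -> K,
  [/\ forall v k x y, c (k *: x + y) v = k * c x v + c y v,
      forall v, B v -> c v v = 1 &
      forall x, finite_set [set v | c x v != 0]].
Proof.
move=> [Bindep Bspan].
have expansion0 g : expansion 0 g -> g = fun=> 0.
  move=> [X [XB gX /esym/(Bindep X g XB) g0]]; apply/funext => v.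
  by have [/g0|/gX] := boolP (v \in X).
have expansion_uniq x g h : expansion x g -> expansion x h -> g = h.
  move=> xg xh; have := expansionP (-1) xg xh.
  rewrite scaleN1r addNr => /expansion0/(congr1 (fun f => f _)) gh.
  by apply/funext => v; have /eqP := gh v; rewrite mulN1r addrC subr_eq0 => /eqP.
have /choice[c cP] x : exists g, expansion x g.
  have [X [a [XB ->]]] := Bspan x.
  exists (fun v => if v \in X then a v else 0), X; split => //.
    by move=> v /negbTE->.
  by apply: eq_big_seq => v ->.
exists c; split.
- move=> v k x y.
  by rewrite (expansion_uniq _ _ _ (cP _) (expansionP k (cP x) (cP y))).
- move=> b Bb.
  rewrite (expansion_uniq _ _ (fun v => (v == b)%:R) (cP b)) ?eqxx //.
  exists [fset b]%fset; split.
  + by move=> v /=; rewrite inE => /eqP->.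
  + by move=> v; rewrite inE => /negbTE->.
  + by rewrite big_seq_fset1 eqxx scale1r.
- move=> x; have [X [_ gX _]] := cP x.
  apply: sub_finite_set (finite_fset X) => v /= cv.
  by apply: contraNT cv => /gX->.
Qed.

End Coordinates.

(** * Coverings that give the upper bounds *)

Section CoveringsFromCoordinates.
Variables (K : fieldType) (V : lmodType K).

Lemma level_sets_irredundant (phi : V -> K) (b : V) :
  (forall k x y, phi (k *: x + y) = k * phi x + phi y) -> phi b = 1 ->
  irredundant_affine_covering [set: K] (fun t => [set x | phi x = t]).
Proof.
move=> lin b1.
have phi0 : phi 0 = 0.
  by have := lin (-1) 0 0; rewrite scaler0 addr0 mulN1r addNr.
have phiZ k : phi (k *: b) = k by rewrite -[k *: b]addr0 lin b1 phi0 addr0 mulr1.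
split; last first.
  move=> J' [_ J'T] J'cover; apply: J'T => t _.
  have : setT (t *: b) by [].
  by rewrite -J'cover => -[u J'u] /=; rewrite phiZ => ->.
split=> [t _|]; last by apply/seteqP; split=> // x _; exists (phi x).
exists (t *: b), [set x | phi x = 0]; split.
- split=> [|k x y]; first exact/mem_set.
  move=> /set_mem/= x0 /set_mem/= y0; apply/mem_set => /=.
  by rewrite lin x0 y0 mulr0 addr0.
- apply/eqP => kerT; have : [set x | phi x = 0] b by rewrite kerT.
  by rewrite /= b1 => /eqP; rewrite oner_eq0.
- apply/seteqP; split=> [x /= xt|_ [w /= w0 <-]]; last first.
    by rewrite lin b1 w0 mulr1 addr0.
  exists (x - t *: b); last by rewrite addrC subrK.
  by rewrite /= addrC -scaleNr lin b1 xt mulr1 addNr.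
Qed.

Lemma infinite_basis_countable_covering (B : set V) :
  is_basis B -> infinite_set B ->
  exists A : nat -> set V, affine_covering [set: nat] A.
Proof.
move=> Bbasis Binf; have [c [lin c1 cfin]] := basis_coordinates Bbasis.
have c0 v : c 0 v = 0.
  by have := lin v (-1) 0 0; rewrite scaler0 addr0 mulN1r addNr.
have [e [eB einj]] : exists e : nat -> V, (forall n, B (e n)) /\ injective e.
  move/infiniteP: Binf => /card_leP[f].
  exists (fun n => val (f (SigSub (in_setT n)))); split.
    by move=> n; apply: set_mem; exact: valP.
  move=> m n /val_inj fmn.
  by have := @inj _ _ _ f _ _ (in_setT _) (in_setT _) fmn; case.
exists (fun n => [set x | forall m, (n <= m)%N -> c x (e m) = 0]); split.
  move=> n _; exists 0, [set x | forall m, (n <= m)%N -> c x (e m) = 0]; split.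
  - split=> [|k x y]; first exact/mem_set.
    move=> /set_mem/= x0 /set_mem/= y0; apply/mem_set => m nm /=.
    by rewrite lin x0 // y0 // mulr0 addr0.
  - apply/eqP => WT.
    have : [set x | forall m, (n <= m)%N -> c x (e m) = 0] (e n) by rewrite WT.
    by move=> /(_ n (leqnn n))/eqP; rewrite c1 // oner_eq0.
  - by rewrite -[LHS]image_id; apply: eq_imagel => x _; rewrite add0r.
apply/seteqP; split=> // x _.
have : finite_set (e @^-1` [set v | c x v != 0]).
  by apply: finite_preimage => // m n _ _; exact: einj.
(* The successor puts the bound strictly above every index with a nonzero coordinate. *)
move=> /finite_seqP[s sE]; exists (\max_(i <- s) i.+1)%N => // m sm.
apply/eqP; apply: contraPT sm => cm.
have ms : m \in s by have : (e @^-1` [set v | c x v != 0]) m by []; rewrite sE.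
apply/negP; rewrite -ltnNge.
exact: (@leq_bigmax_seq _ s xpredT succn m ms).
Qed.

End CoveringsFromCoordinates.

(** * The covering numbers *)

Theorem theorem6 (K : fieldType) (V : lmodType K)
    (hV : cardinal_le (card_of `I_1) (vdim V)) :
  (cardinal_finite (cardinal_min (vdim V) (card_of [set: K])) ->
     AC V = card_of [set: K]) /\
  (~ cardinal_finite (vdim V) -> ~ cardinal_finite (card_of [set: K]) ->
     AC V = aleph0) /\
  IAC V = card_of [set: K].
Proof.
have [B Bbasis [b Bb]] : exists2 B : set V, is_basis B & B !=set0.
  have [T [A [U [C [/= A1 [B Bbasis BC] leAC]]]]] := hV.
  exists B => //; apply/set0P/eqP => B0.
  move: BC A1 leAC; rewrite /card_of B0 => /card_le_eqr<- /card_le_eql<-.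
  by move=> /card_le0P I0; have : `I_1 0%N by []; rewrite I0.
have [c [lin c1 _]] := basis_coordinates Bbasis.
have levels := level_sets_irredundant (lin b) (c1 b Bb).
split; [|split].
- move=> minfin; apply/least_cardinalP; split.
    by exists K, setT, (fun t => [set x | c x b = t]); split; [exact: levels.1|].
  move=> _ [I [J [A [AJ ->]]]]; apply/cardinal_le_card_of.
  have [Jfin|Jinf] := pselect (finite_set J).
    exact: (finite_affine_covering_card AJ Jfin).
  (* Either the minimum is the dimension and some basis is finite, or it is the cardinality of [K],
     which is then finite and so at most that of the infinite [J]. *)
  move: minfin; rewrite /cardinal_min; case: asboolP => _.
    move=> [T [C [[B' [_ B'span] B'C] Cfin]]].
    apply: (fin_dim_affine_covering_card AJ B'span).
    by rewrite (eq_finite_set B'C).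
  move=> /cardinal_finite_card_of/finite_set_countable Kc.
  exact: (card_le_trans Kc ((infiniteP J).1 Jinf)).
- move=> diminf Kinf; apply/least_cardinalP.
  have Binf : infinite_set B.
    move=> Bfin; apply: diminf; exists V, B; split => //.
    by exists B => //; exact: card_eqxx.
  split.
    have [A AP] := infinite_basis_countable_covering Bbasis Binf.
    by exists nat, setT, A.
  (* A finite covering would bound the cardinality of [K] and make [K] finite. *)
  move=> _ [I [J [A [AJ ->]]]]; apply/cardinal_le_card_of/infiniteP => Jfin.
  apply: Kinf; apply/cardinal_finite_card_of.
  exact: (card_le_finite (finite_affine_covering_card AJ Jfin) Jfin).
- apply/least_cardinalP; split.
    by exists K, setT, (fun t => [set x | c x b = t]).
  move=> _ [I [J [A [AJ ->]]]]; apply/cardinal_le_card_of.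
  exact: (irredundant_affine_covering_card AJ.1 AJ).
Qed.
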